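(* Let $(X,\mu)$ be a standard probability space and let $T\in\mathrm{Aut}(X,\mu)$ be ergodic. Then neither the derived group $D([T]_1)$ nor its closure $\overline{D([T]_1)}$ in $[T]_1$ is simple (as an abstract group).
   Context: A standard probability space $(X,\mu)$ is a standard Borel space with a non-atomic Borel probability measure. $\mathrm{Aut}(X,\mu)$ is the group of measure-preserving Borel bijections of $X$, identified when they agree almost everywhere. $T$ is ergodic if every Borel set which is a union of $T$-orbits has measure $0$ or $1$ (then a.e. orbit is infinite). Set $[T]=\{U\in\mathrm{Aut}(X,\mu): U(x)\in\{T^n(x):n\in\mathbb Z\}\text{ for a.e. }x\}$; each $U\in[T]$ has a cocycle $c_U:X\to\mathbb Z$ defined by $U(x)=T^{c_U(x)}(x)$. The $\mathrm L^1$ full group is $[T]_1=\{U\in[T]:\int_X|c_U|\,d\mu<+\infty\}$, with the topology induced by the metric $\tilde d_T(U,V)=\int_X|c_U-c_V|\,d\mu$. $D(G)$ denotes the derived subgroup of $G$. *)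

(* Defs.v *)
From HB Require Import structures.
From mathcomp Require Import all_boot all_order all_algebra.
From mathcomp Require Import all_classical all_reals all_analysis.

Set Implicit Arguments.
Unset Strict Implicit.
Unset Printing Implicit Defensive.

Import Order.TTheory GRing.Theory Num.Theory.

Local Open Scope classical_set_scope.
Local Open Scope ring_scope.
Local Open Scope quotient_scope.

Section abstract_groups.
Local Open Scope group_scope.
Context {G : groupType}.
Implicit Types H N K : set G.

Definition is_subgroup H :=
  H 1 /\ forall x y, H x -> H y -> H (x * y^-1).

Definition derived_subgroup H : set G :=
  smallest is_subgroup [set commg x y | x in H & y in H].

Definition is_normal_subgroup N H :=
  [/\ is_subgroup N, N `<=` H & forall x y, H x -> N y -> N (y ^ x)].

Definition is_simple H :=
  H <> [set 1] /\
  forall N, is_normal_subgroup N H -> N = [set 1] \/ N = H.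

End abstract_groups.

Section standard_probability_space.
Context d (X : measurableType d) (R : realType).

(* A [completePseudoMetricType] that is Hausdorff is a complete metric space. *)
Definition standard_borel :=
  exists Y : completePseudoMetricType R,
    [/\ hausdorff_space Y,
        (exists2 S : set Y, countable S & dense S) &
        exists2 f : X -> Y, bijective f &
          forall A : set X, measurable A <-> <<s @open Y >> (f @` A)].

Definition is_atom (mu : set X -> \bar R) (A : set X) :=
  [/\ measurable A, (0 < mu A)%E &
      forall B, measurable B -> B `<=` A -> mu B = 0%E \/ mu B = mu A].

Definition standard_probability_space (mu : probability X R) :=
  standard_borel /\ forall A, ~ is_atom mu A.

End standard_probability_space.

Section automorphisms.
Context d (X : measurableType d) (R : realType) (mu : probability X R).

(* Measurability of the inverse is automatic on a standard Borel space
   (Lusin-Souslin). *)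
Record mpbij := Mpbij {
  mpbij_fun :> X -> X ;
  mpbij_inv : X -> X ;
  mpbij_funK : cancel mpbij_fun mpbij_inv ;
  mpbij_invK : cancel mpbij_inv mpbij_fun ;
  mpbij_measurable : measurable_fun setT mpbij_fun ;
  mpbij_inv_measurable : measurable_fun setT mpbij_inv ;
  mpbij_preserving : forall A, measurable A -> mu (mpbij_fun @^-1` A) = mu A
}.

HB.instance Definition _ := gen_eqMixin mpbij.
HB.instance Definition _ := gen_choiceMixin mpbij.

Implicit Types f g t u : mpbij.

Lemma mpbij_measurable_preimage f (A : set X) :
  measurable A -> measurable (f @^-1` A).
Proof.
by move=> mA; rewrite -[X in measurable X]setTI; exact: mpbij_measurable.
Qed.

Definition mpbij_id : mpbij :=
  @Mpbij id id (fun=> erefl) (fun=> erefl) (@measurable_id _ _ _)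
    (@measurable_id _ _ _) (fun _ _ => erefl).

Lemma mpbij_comp_preserving f g (A : set X) :
  measurable A -> mu ((f \o g) @^-1` A) = mu A.
Proof.
move=> mA; rewrite comp_preimage mpbij_preserving ?mpbij_preserving//.
exact: mpbij_measurable_preimage.
Qed.

Definition mpbij_comp f g : mpbij :=
  @Mpbij (f \o g) (mpbij_inv g \o mpbij_inv f)
    (can_comp (mpbij_funK f) (mpbij_funK g))
    (can_comp (mpbij_invK g) (mpbij_invK f))
    (measurableT_comp (mpbij_measurable f) (mpbij_measurable g))
    (measurableT_comp (mpbij_inv_measurable g) (mpbij_inv_measurable f))
    (@mpbij_comp_preserving f g).

Lemma mpbij_inv_preserving f (A : set X) :
  measurable A -> mu (mpbij_inv f @^-1` A) = mu A.
Proof.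
move=> mA; rewrite -(mpbij_preserving f); last first.
  by rewrite -[X in measurable X]setTI; exact: mpbij_inv_measurable.
rewrite -comp_preimage (_ : mpbij_inv f \o f = id)//.
exact/funext/mpbij_funK.
Qed.

Definition mpbij_sym f : mpbij :=
  @Mpbij (mpbij_inv f) f (mpbij_invK f) (mpbij_funK f)
    (mpbij_inv_measurable f) (mpbij_measurable f) (@mpbij_inv_preserving f).

Definition mpbij_ae_eq f g := `[< {ae mu, forall x, f x = g x} >].

Lemma mpbij_ae_eq_refl : reflexive mpbij_ae_eq.
Proof. by move=> f; apply/asboolP; apply: aeW. Qed.

Lemma mpbij_ae_eq_sym : symmetric mpbij_ae_eq.
Proof.
suff H f g : mpbij_ae_eq f g -> mpbij_ae_eq g f.
  by move=> f g; apply/idP/idP; exact: H.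
by move=> /asboolP fg; apply/asboolP; apply: filterS fg => x.
Qed.

Lemma mpbij_ae_eq_trans : transitive mpbij_ae_eq.
Proof.
move=> g f h /asboolP fg /asboolP gh; apply/asboolP.
by apply: filterS2 fg gh => x -> ->.
Qed.

Canonical mpbij_ae_eq_equiv := EquivRel mpbij_ae_eq
  mpbij_ae_eq_refl mpbij_ae_eq_sym mpbij_ae_eq_trans.

Definition Aut : Type := {eq_quot mpbij_ae_eq}.
HB.instance Definition _ := Choice.on Aut.
HB.instance Definition _ := EqQuotient.on Aut.

Definition Aut_repr (U : Aut) : mpbij := repr U.
Coercion Aut_repr : Aut >-> mpbij.

Lemma Aut_eqP f g :
  \pi_Aut f = \pi_Aut g <-> {ae mu, forall x, f x = g x}.
Proof.
split=> [/eqP|fg]; first by rewrite eqmodE => /asboolP.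
by apply/eqP; rewrite eqmodE; apply/asboolP.
Qed.

Lemma Aut_repr_pi f : {ae mu, forall x, Aut_repr (\pi_Aut f) x = f x}.
Proof. by apply/Aut_eqP; rewrite /Aut_repr reprK. Qed.

Lemma ae_preimage f (P : X -> Prop) :
  {ae mu, forall x, P x} -> {ae mu, forall x, P (f x)}.
Proof.
move=> [A [mA A0 PA]]; exists (f @^-1` A); split.
- exact: mpbij_measurable_preimage.
- by rewrite mpbij_preserving.
- by move=> x nP; apply: PA.
Qed.

Lemma ae_inv_eq f g : {ae mu, forall x, f x = g x} ->
  {ae mu, forall x, mpbij_inv f x = mpbij_inv g x}.
Proof.
move=> /(@ae_preimage (mpbij_sym f)); apply: filterS => x /=.
by rewrite mpbij_invK => {2}->; rewrite mpbij_funK.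
Qed.

Definition Aut_one : Aut := \pi_Aut mpbij_id.
Definition Aut_mul (U V : Aut) : Aut := \pi_Aut (mpbij_comp U V).
Definition Aut_inv (U : Aut) : Aut := \pi_Aut (mpbij_sym U).

Lemma pi_mpbij_comp f g :
  Aut_mul (\pi_Aut f) (\pi_Aut g) = \pi_Aut (mpbij_comp f g).
Proof.
apply/Aut_eqP.
apply: filterS2 (ae_preimage (Aut_repr (\pi_Aut g)) (Aut_repr_pi f)) (Aut_repr_pi g).
by move=> x /= -> ->.
Qed.

Lemma pi_mpbij_sym f : Aut_inv (\pi_Aut f) = \pi_Aut (mpbij_sym f).
Proof. exact/Aut_eqP/ae_inv_eq/Aut_repr_pi. Qed.

Lemma Aut_mulA : associative Aut_mul.
Proof.
move=> U V W; rewrite -(reprK U) -(reprK V) -(reprK W).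
move: (repr U) (repr V) (repr W) => f g h.
rewrite (pi_mpbij_comp g h) (pi_mpbij_comp f g) !pi_mpbij_comp.
exact/Aut_eqP/aeW.
Qed.

Lemma Aut_mul1 : left_id Aut_one Aut_mul.
Proof. by move=> U; rewrite -(reprK U) pi_mpbij_comp; apply/Aut_eqP/aeW. Qed.

Lemma Aut_mulr1 : right_id Aut_one Aut_mul.
Proof. by move=> U; rewrite -(reprK U) pi_mpbij_comp; apply/Aut_eqP/aeW. Qed.

Lemma Aut_mulV : left_inverse Aut_one Aut_inv Aut_mul.
Proof.
move=> U; rewrite -(reprK U) pi_mpbij_sym pi_mpbij_comp.
by apply/Aut_eqP/aeW => x /=; rewrite mpbij_funK.
Qed.

Lemma Aut_mulrV : right_inverse Aut_one Aut_inv Aut_mul.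
Proof.
move=> U; rewrite -(reprK U) pi_mpbij_sym pi_mpbij_comp.
by apply/Aut_eqP/aeW => x /=; rewrite mpbij_invK.
Qed.

HB.instance Definition _ :=
  isGroup.Build Aut Aut_mulA Aut_mul1 Aut_mulr1 Aut_mulV Aut_mulrV.

Definition mpbij_iter t (n : int) (x : X) : X :=
  match n with
  | Posz k => iter k t x
  | Negz k => iter k.+1 (mpbij_inv t) x
  end.

Definition mpbij_orbit t (x : X) : set X := range (mpbij_iter t ^~ x).

Definition mpbij_ergodic t :=
  forall A : set X, measurable A -> (forall x, A x -> mpbij_orbit t x `<=` A) ->
  mu A = 0%E \/ mu A = 1%E.

(* If [u x] is in the [t]-orbit of [x] and the orbit is infinite, this is the
   unique [n] such that [u x = t^n x]; otherwise it is a default value. *)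
Definition mpbij_cocycle t u (x : X) : int :=
  xget 0 [set n | u x = mpbij_iter t n x].

(* The notions below are those of arbitrary representatives; the lemmas ending
   in [_ae_eq] show that they only depend on the classes. *)
Definition ergodic (T : Aut) := mpbij_ergodic T.

Definition cocycle (T U : Aut) : X -> int := mpbij_cocycle T U.

Definition full_group (T : Aut) : set Aut :=
  [set U : Aut | {ae mu, forall x, mpbij_orbit T x (U x)}].

Definition L1_full_group (T : Aut) : set Aut :=
  [set U | full_group T U /\
           (\int[mu]_x (`|cocycle T U x|%:~R : R)%:E < +oo)%E].

Definition L1_dist (T U V : Aut) : \bar R :=
  (\int[mu]_x (`|cocycle T U x - cocycle T V x|%:~R : R)%:E)%E.

Definition L1_closure (T : Aut) (H : set Aut) : set Aut :=
  [set U | L1_full_group T U /\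
     forall e : R, 0 < e -> exists2 V, H V & (L1_dist T U V < e%:E)%E].

Lemma mpbij_iterS t n x : mpbij_iter t (n + 1) x = t (mpbij_iter t n x).
Proof.
case: n => [n|[|n]]; first by rewrite addrC -intS.
- by rewrite NegzE addNr /= mpbij_invK.
- by rewrite NegzE intS opprD addrAC addNr add0r -NegzE /= mpbij_invK.
Qed.

Lemma mpbij_iterD t m n x :
  mpbij_iter t (m + n) x = mpbij_iter t m (mpbij_iter t n x).
Proof.
elim: m => [|m IH|m IH]; first by rewrite add0r.
- by rewrite intS [1 + _]addrC addrAC !mpbij_iterS IH.
- have mE : - m.+1%:Z + 1 = - m%:Z by rewrite intS opprD addrAC addNr add0r.
  apply: (can_inj (mpbij_funK t)).
  by rewrite -!mpbij_iterS addrAC mE IH.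
Qed.

Lemma mpbij_iter_ae_eq t u : {ae mu, forall x, t x = u x} ->
  {ae mu, forall x, forall n, mpbij_iter t n x = mpbij_iter u n x}.
Proof.
have iterP f g k : {ae mu, forall x, f x = g x} ->
    {ae mu, forall x, iter k f x = iter k g x}.
  move=> fg; elim: k => [|k IH]; first exact: aeW.
  apply: filterS2 (ae_preimage f IH) fg => x.
  by rewrite !iterSr => -> ->.
move=> tu; have tu' := ae_inv_eq tu.
have H1 : {ae mu, forall x, forall k, iter k t x = iter k u x}.
  by apply/ae_foralln => k; exact: iterP.
have H2 : {ae mu, forall x, forall k,
    iter k (mpbij_inv t) x = iter k (mpbij_inv u) x}.
  by apply/ae_foralln => k; exact: (iterP (mpbij_sym t) (mpbij_sym u)).
by apply: filterS2 H1 H2 => x h1 h2 [n|n]; [exact: h1|exact: h2].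
Qed.

Lemma mpbij_orbit_ae_eq t u : {ae mu, forall x, t x = u x} ->
  {ae mu, forall x, mpbij_orbit t x = mpbij_orbit u x}.
Proof.
move=> /mpbij_iter_ae_eq; apply: filterS => x tu.
by rewrite /mpbij_orbit; congr (_ @` _); apply/funext => n; exact: tu.
Qed.

Lemma mpbij_cocycle_ae_eq t t' u u' :
  {ae mu, forall x, t x = t' x} -> {ae mu, forall x, u x = u' x} ->
  {ae mu, forall x, mpbij_cocycle t u x = mpbij_cocycle t' u' x}.
Proof.
move=> /mpbij_iter_ae_eq; apply: filterS2 => x tt' uu'.
rewrite /mpbij_cocycle; congr xget; apply/funext => n /=.
by rewrite tt' uu'.
Qed.

Lemma mpbij_iter_measurable t n (A : set X) :
  measurable A -> measurable (mpbij_iter t n @^-1` A).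
Proof.
move=> mA; have iterP f k : measurable (iter k (mpbij_fun f) @^-1` A).
  elim: k => [|k IH] //.
  rewrite (_ : _ @^-1` _ = f @^-1` (iter k f @^-1` A)).
    exact: mpbij_measurable_preimage.
  by apply/funext => x /=; rewrite -iterS iterSr.
by case: n => n; [exact: iterP|exact: (iterP (mpbij_sym t) n.+1)].
Qed.

Lemma mpbij_ergodic_ae_eq t u : {ae mu, forall x, t x = u x} ->
  mpbij_ergodic t -> mpbij_ergodic u.
Proof.
move=> /mpbij_iter_ae_eq tu ergt A mA Au.
pose B := \bigcap_(k in [set: int]) (mpbij_iter t k @^-1` A).
have mB : measurable B.
  rewrite -[X in measurable X]setCK setC_bigcap; apply: measurableC.
  apply: countable_bigcupT_measurable => // k.
  exact/measurableC/mpbij_iter_measurable.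
have <- : mu B = mu A.
  apply/eqP; rewrite eq_le le_measure ?inE//=; last by move=> x /(_ 0 I).
  have [N [mN N0 tuN]] := tu.
  rewrite -[leRHS]adde0 -N0; apply: le_trans (measureU2 _ _ _) => //.
  apply: le_measure; rewrite ?inE//; first exact: measurableU.
  move=> x Ax; have [Nx|Nx] := pselect (N x); [by right|left => k _ /=].
  have -> : mpbij_iter t k x = mpbij_iter u k x.
    by apply: contrapT => h; apply: Nx; apply: tuN => /(_ k).
  by apply: (Au x Ax); exists k.
apply: ergt => // x Bx _ [k _ <-] m _ /=; rewrite -mpbij_iterD; exact: Bx.
Qed.

End automorphisms.

(* Main.v *)
Require Import Defs.
From mathcomp Require Import all_boot all_order all_algebra.
From mathcomp Require Import all_classical all_reals all_analysis.
From mathcomp Require Import measurable_realfun zify lra.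

(** Fix a function [phi] on [X], with values in [[0, +oo]], that changes by at
    most [|n|] between [x] and [T^n x].  If [V] lies in the L1 full group, then
    [phi (V x) <= phi x + |c_V x|] with [c_V] integrable, and the support of
    [V^-1 U V] is the image under [V^-1] of the support of [U].  Hence the
    elements [U] of the derived group [D] such that [phi] is integrable on the
    support of [U] form a subgroup [N] which is normalised by the whole L1 full
    group, so by [D] and by the closure of [D].  Both groups contain [N], and
    neither is simple as soon as [N] is neither trivial nor all of [D].

    The function [phi] is chosen non-integrable and zero on a set [Z] of
    positive measure ([exists_nonintegrable_lipschitz]): it is a supremum of
    cones along the orbits.  A set [B] of tiny measure has neighbourhoods
    [{x | exists n, |n| <= p /\ T^n x \in B}] whose measure grows with [p]
    slowly and, by ergodicity, up to 1.  At the first radius [p] where this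
    measure reaches a given [e], doubling the radius at most triples it, while
    [p * e] is as large as desired provided that [B] was small enough.  A cone
    of height [2p] above [B] then has a large integral and a small support
    ([ergodic_bump]).

    Elements of [D] come from sets [E] that are disjoint from [T E] and [T^2 E].
    The commutator of the involution exchanging [E] with [T E] and the one
    exchanging [T E] with [T^2 E] is a 3-cycle whose support is the union of the
    three sets ([three_cycle_in_derived]).
    - If [E] is contained in [Z], then [phi <= 2] on that support, so that the
      3-cycle is a nontrivial element of [N].
    - If every point is within distance 2 of [E] along its orbit
      ([exists_syndetic_spaced]), then integrability of [phi] on [E] would imply
      integrability on [X], so that the 3-cycle is not in [N].

    Cocycles are only almost everywhere equal to measurable functions.
    Integrability is therefore expressed by almost everywhere domination by a
    measurable function of finite integral ([L1_bounded]), and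
    [L1_full_groupP] translates membership in the L1 full group into these
    terms; this uses that the orbits of an ergodic transformation of a nonatomic
    space are almost all infinite ([ergodic_aperiodic]). *)

Set Implicit Arguments.
Unset Strict Implicit.
Unset Printing Implicit Defensive.

Import Order.TTheory GRing.Theory Num.Theory.

Local Open Scope classical_set_scope.
Local Open Scope ring_scope.

(** * Powers of a transformation *)

Section powers.
Context d (X : measurableType d) (R : realType) (mu : probability X R).
Implicit Types (t f : mpbij mu) (n m : int).

Lemma mpbij_iterK t n : cancel (mpbij_iter t n) (mpbij_iter t (- n)).
Proof. by move=> x; rewrite -mpbij_iterD addNr. Qed.

Lemma mpbij_iterVK t n : cancel (mpbij_iter t (- n)) (mpbij_iter t n).
Proof. by move=> x; rewrite -mpbij_iterD subrr. Qed.

Lemma mpbij_iter_measurable_fun t n : measurable_fun setT (mpbij_iter t n).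
Proof. by move=> _ A mA; rewrite setTI; exact: mpbij_iter_measurable. Qed.

Lemma mpbij_iter_preserving t n (A : set X) : measurable A ->
  mu (mpbij_iter t n @^-1` A) = mu A.
Proof.
have pos (k : nat) B : measurable B -> mu (mpbij_iter t k%:Z @^-1` B) = mu B.
  elim: k B => [//|k IH] B mB.
  have -> : mpbij_iter t k.+1 @^-1` B = mpbij_iter t k @^-1` (t @^-1` B).
    by apply/funext => x /=.
  by rewrite IH ?mpbij_preserving//; exact: mpbij_measurable_preimage.
case: n => k mA; first exact: pos.
rewrite NegzE -[LHS](pos k.+1); last exact: mpbij_iter_measurable.
congr (mu _); apply/funext => x.
by rewrite /preimage /mkset mpbij_iterK.
Qed.

Definition mpbij_pow t n : mpbij mu :=
  Mpbij (mpbij_iterK t n) (mpbij_iterVK t n)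
    (mpbij_iter_measurable_fun t n) (mpbij_iter_measurable_fun t (- n))
    (@mpbij_iter_preserving t n).

Lemma mpbij_iterC t n m x :
  mpbij_iter t n (mpbij_iter t m x) = mpbij_iter t m (mpbij_iter t n x).
Proof. by rewrite -!mpbij_iterD addrC. Qed.

End powers.

(** * Domination by integrable functions *)

Section integrable_bounds.
Context d (X : measurableType d) (R : realType) (mu : probability X R).
Implicit Types (f : mpbij mu) (P Q : X -> \bar R -> Prop).
Local Open Scope ereal_scope.

(** Cocycles may fail to be measurable on a null set.  Monotonicity survives,
    because the integral of a nonnegative function is by definition a supremum
    over the simple functions below it. *)
Lemma integral_le_nonmeasurable (f g : X -> \bar R) :
  (forall x, 0 <= f x) -> (forall x, f x <= g x) ->
  \int[mu]_x f x <= \int[mu]_x g x.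
Proof.
move=> f0 fg; have g0 x : 0 <= g x by exact: le_trans (fg x).
rewrite !ge0_integralTE//; apply: le_ereal_sup => _ [h hf <-].
by exists h => // x; exact: le_trans (fg x).
Qed.

(** [P x r] is to be read as: [r] bounds some quantity attached to [x].  When
    the quantity is a function [f], with [P x r := f x <= r], this says that
    the possibly non-measurable function [f] has an upper integral less than
    [+oo]. *)
Definition L1_bounded P := exists h : X -> \bar R,
  [/\ measurable_fun setT h, (forall x, 0 <= h x),
      \int[mu]_x h x < +oo & {ae mu, forall x, P x (h x)}].

Lemma mpbij_integral f (h : X -> \bar R) : measurable_fun setT h ->
  (forall x, 0 <= h x) -> \int[mu]_x h (f x) = \int[mu]_x h x.
Proof.
move=> mh h0; have mf := mpbij_measurable f.
rewrite -[LHS](@ge0_integral_pushforward _ _ _ _ _ f mf mu setT h)//.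
by apply: eq_measure_integral => A mA _; exact: mpbij_preserving.
Qed.

Lemma L1_bounded_comp f P : L1_bounded P -> L1_bounded (fun x => P (f x)).
Proof.
move=> [h [mh h0 hoo Ph]]; exists (fun x => h (f x)); split => //.
- by apply: (measurableT_comp mh); exact: mpbij_measurable.
- by rewrite mpbij_integral.
- exact: ae_preimage Ph.
Qed.

Lemma L1_boundedD P Q S : L1_bounded P -> L1_bounded Q ->
  {ae mu, forall x, forall r s, 0 <= r -> 0 <= s -> P x r -> Q x s -> S x (r + s)} ->
  L1_bounded S.
Proof.
move=> [h [mh h0 hoo Ph]] [k [mk k0 koo Qk]] PQS.
exists (fun x => h x + k x); split.
- exact: emeasurable_funD.
- by move=> x; exact: adde_ge0.
- by rewrite ge0_integralD//; exact: lte_add_pinfty.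
- by apply: filterS3 Ph Qk PQS => x Px Qx; apply.
Qed.

Lemma L1_bounded_mono P Q : L1_bounded P ->
  {ae mu, forall x, forall r, P x r -> Q x r} -> L1_bounded Q.
Proof.
move=> [h [mh h0 hoo Ph]] PQ; exists h; split => //.
by apply: filterS2 Ph PQ => x Px; apply.
Qed.

Lemma L1_bounded_cst (c : R) P : (0 <= c)%R -> {ae mu, forall x, P x c%:E} ->
  L1_bounded P.
Proof.
move=> c0 Pc; exists (cst c%:E); split => //.
by rewrite integral_cst// [X in _ * X](probability_setT mu) mule1 ltry.
Qed.

End integrable_bounds.

(** * Derived subgroups and simplicity *)

Section abstract_groups.
Local Open Scope group_scope.
Context {G : groupType}.
Implicit Types H K N : set G.

Lemma is_subgroupV H x : is_subgroup H -> H x -> H x^-1.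
Proof. by move=> [H1 HM] Hx; rewrite -[_^-1]mul1g; exact: HM. Qed.

Lemma is_subgroupM H x y : is_subgroup H -> H x -> H y -> H (x * y).
Proof.
by move=> gH Hx Hy; rewrite -[y]invgK; apply: (gH.2) => //; exact: is_subgroupV.
Qed.

Lemma is_subgroupJ H x y : is_subgroup H -> H x -> H y -> H (x ^ y).
Proof.
move=> gH Hx Hy; rewrite conjgE; apply: is_subgroupM => //.
- exact: is_subgroupV.
- exact: is_subgroupM.
Qed.

Lemma derived_subgroup_is_subgroup H : is_subgroup (derived_subgroup H).
Proof.
split; first by move=> K [[]].
by move=> x y Hx Hy K KH; apply: KH.1.2; [exact: Hx|exact: Hy].
Qed.

Lemma derived_subgroup_commg H x y :
  H x -> H y -> derived_subgroup H (commg x y).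
Proof. by move=> Hx Hy K [_]; apply; exists x => //; exists y. Qed.

Lemma derived_subgroup_sub H : is_subgroup H -> derived_subgroup H `<=` H.
Proof.
move=> gH x; apply; split => // _ [a Ha [b Hb <-]]; rewrite commgEl.
apply: is_subgroupM => //; first exact: is_subgroupV.
exact: is_subgroupJ.
Qed.

Lemma derived_subgroup_conjg H x y : is_subgroup H ->
  derived_subgroup H x -> H y -> derived_subgroup H (x ^ y).
Proof.
move=> gH Dx Hy; have gD := derived_subgroup_is_subgroup H.
apply: (Dx [set z | derived_subgroup H (z ^ y)]); split.
  split => /=; first by rewrite conj1g; exact: gD.1.
  by move=> a b Da Db; rewrite conjMg conjVg; exact: gD.2.
move=> _ [a Ha [b Hb <-]] /=; rewrite conjRg.
by apply: derived_subgroup_commg; exact: is_subgroupJ.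
Qed.

(** [N] is normalised by the larger set [K], so that a single [N] can serve both
    for a derived subgroup and for its closure. *)
Lemma not_simple H K N x y : is_subgroup N ->
  (forall a b, K b -> N a -> N (a ^ b)) ->
  H `<=` K -> N `<=` H -> N x -> x <> 1 -> H y -> ~ N y -> ~ is_simple H.
Proof.
move=> gN NK HK NH Nx x1 Hy Ny [_ /(_ N)] [].
- by split => // a b Ha; apply: NK; exact: HK.
- by move=> N1; move: Nx; rewrite N1.
- by move=> NE; apply: Ny; rewrite NE.
Qed.

End abstract_groups.

(** * Classes of transformations, pointwise *)

Section pointwise.
Context d (X : measurableType d) (R : realType) (mu : probability X R).
Implicit Types U V W : Aut mu.

Lemma Aut_mulE U V : {ae mu, forall x, (U * V : Aut mu)%g x = U (V x)}.
Proof. exact: Aut_repr_pi. Qed.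

Lemma Aut_invE U : {ae mu, forall x, (U^-1 : Aut mu)%g x = mpbij_inv U x}.
Proof. exact: Aut_repr_pi. Qed.

Lemma Aut_oneE : {ae mu, forall x, (1 : Aut mu)%g x = x}.
Proof. exact: Aut_repr_pi. Qed.

Lemma Aut_divE U V :
  {ae mu, forall x, (U * V^-1 : Aut mu)%g x = U (mpbij_inv V x)}.
Proof.
by apply: filterS2 (Aut_mulE U (V^-1)%g) (Aut_invE V) => x -> ->.
Qed.

Lemma Aut_conjE U V :
  {ae mu, forall x, (U ^ V : Aut mu)%g x = mpbij_inv V (U (V x))}.
Proof.
have h1 := Aut_mulE (V^-1)%g (U * V)%g.
have h2 := Aut_mulE U V.
have h3 := ae_preimage V (ae_preimage U (Aut_invE V)).
by apply: filterS3 h1 h2 h3 => x; rewrite conjgE => -> -> ->.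
Qed.

End pointwise.

(** * Integrable displacement *)

Section L1.
Context d (X : measurableType d) (R : realType) (mu : probability X R).
Variable t : mpbij mu.

(** Stated through some exponent [n] rather than through the cocycle, so that
    composition and inversion behave well at every point, including the points
    with a finite orbit. *)
Definition displaced_by (u : mpbij mu) (x : X) (r : \bar R) :=
  exists2 n : int, u x = mpbij_iter t n x & (`|n|%:~R%:E <= r)%E.

Definition L1_displacement (u : mpbij mu) := L1_bounded mu (displaced_by u).

Lemma L1_displacement_ae_eq (u v : mpbij mu) : {ae mu, forall x, u x = v x} ->
  L1_displacement u -> L1_displacement v.
Proof.
move=> uv /L1_bounded_mono; apply; apply: filterS uv => x uv r [n un nr].
by exists n => //; rewrite -uv.
Qed.

Lemma L1_displacement_id : L1_displacement (mpbij_id mu).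
Proof.
apply: (@L1_bounded_cst _ _ _ _ 0) => //.
by apply: aeW => x; exists 0.
Qed.

Lemma L1_displacement_comp (u v : mpbij mu) :
  L1_displacement u -> L1_displacement v -> L1_displacement (mpbij_comp u v).
Proof.
move=> /(@L1_bounded_comp _ _ _ _ v) Lu Lv; apply: (L1_boundedD Lu Lv).
apply: aeW => x r s r0 s0 [n un nr] [m vm ms]; exists (n + m).
  by rewrite mpbij_iterD -vm -un.
apply: le_trans (leeD nr ms); rewrite -EFinD lee_fin -rmorphD/= ler_int.
exact: ler_normD.
Qed.

Lemma L1_displacement_sym (u : mpbij mu) :
  L1_displacement u -> L1_displacement (mpbij_sym u).
Proof.
move=> /(@L1_bounded_comp _ _ _ _ (mpbij_sym u)) /L1_bounded_mono; apply.
apply: aeW => x r [n /= un nr]; exists (- n); last by rewrite normrN.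
by rewrite mpbij_invK in un; rewrite {2}un mpbij_iterK.
Qed.

End L1.

(** * Countable separation in standard Borel spaces *)

Section separation.
Context d (X : measurableType d) (R : realType).

Definition separating (O : (set X)^nat) :=
  (forall k, measurable (O k)) /\
  forall x y, x <> y -> exists2 k, O k x & ~ O k y.

(** Interiors are taken because the balls of a pseudometric structure need not
    be open. *)
Lemma hausdorff_ball_separation (Y : completePseudoMetricType R) (S : set Y) a b :
  hausdorff_space Y -> dense S -> a <> b ->
  exists s n, [/\ S s, (ball s n.+1%:R^-1)° a & ~ (ball s n.+1%:R^-1)° b].
Proof.
rewrite open_hausdorff => hY dS /eqP /hY[[A B]/= [/set_mem Aa /set_mem Bb] [oA oB AB]].
have /nbhs_ballP[e /= e0 eA] : nbhs a A by exact: open_nbhs_nbhs.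
have [n] : exists n, 0 + n.+1%:R^-1 < e / 2 by apply: ltr_add_invr; lra.
rewrite add0r => ne; set r := n.+1%:R^-1 in ne *.
have r0 : 0 < r by rewrite invr_gt0 ltr0n.
have [s [sa Ss]] : ((ball a (r / 2))° `&` S) !=set0.
  apply: dS; last exact: open_interior.
  by exists a; apply: nbhsx_ballx; lra.
exists s, n; have /ball_sym sa' := interior_subset sa; split => //.
  apply/nbhs_ballP; exists (r / 2) => /=; first lra.
  move=> z az; rewrite -/r (_ : r = r / 2 + r / 2); last lra.
  exact: ball_triangle sa' az.
move=> /interior_subset; rewrite -/r => sb.
have : A b.
  apply: eA; apply: (@le_ball _ _ _ (r / 2 + r)); first lra.
  exact: ball_triangle (interior_subset sa) sb.
move=> Ab; move/eqP: AB; rewrite -subset0 => /(_ b); apply.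
by split.
Qed.

Lemma standard_borel_separating : standard_borel X R -> exists O, separating O.
Proof.
move=> [Y [hY [S cS dS] [f [g fK gK] mf]]].
have sep x y : x <> y -> exists s n,
    [/\ S s, (f @^-1` (ball s n.+1%:R^-1)°) x & ~ (f @^-1` (ball s n.+1%:R^-1)°) y].
  move=> xy; apply: hausdorff_ball_separation => // /(can_inj fK); exact: xy.
have mB s n : measurable (f @^-1` (ball s n.+1%:R^-1)°).
  apply/mf; rewrite image_preimage.
    by apply: sub_gen_smallest; exact: open_interior.
  by rewrite -subTset => y _; exists (g y).
have /pfcard_geP[S0|/unsquash e] := cS.
  exists (fun=> set0); split => // x y /sep[s [n []]]; by rewrite S0.
pose p k : nat * nat := odflt (0%N, 0%N) (unpickle k).
exists (fun k => f @^-1` (ball (e (p k).1) (p k).2.+1%:R^-1)°); split => [k|x y].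
  exact: mB.
move=> /sep[s [n [Ss sx sy]]].
have [i _ ei] : (e @` setT) s by exact: surj.
by exists (pickle (i, n)); rewrite /p pickleK /= ei.
Qed.

(** The diagonal is measurable as soon as countably many measurable sets
    separate the points. *)
Lemma separating_neq_measurable O (f g : X -> X) : separating O ->
  measurable_fun setT f -> measurable_fun setT g ->
  measurable [set x | f x <> g x].
Proof.
move=> [mO sO] mf mg.
have -> : [set x | f x <> g x] = \bigcup_k (f @^-1` (O k) `\` g @^-1` (O k)).
  apply/seteqP; split => [x /= /sO[k]|x [k _ [/= fx gx]] fg]; first by exists k.
  by apply: gx; rewrite -fg.
apply: bigcupT_measurable => k; apply: measurableD.
- by rewrite -[X in measurable X]setTI; exact: mf.
- by rewrite -[X in measurable X]setTI; exact: mg.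
Qed.

End separation.

(** * Small sets in nonatomic spaces *)

Section small_sets.
Context d (X : measurableType d) (R : realType) (mu : probability X R).
Local Open Scope ereal_scope.
Hypothesis noatom : forall A, ~ is_atom mu A.

Lemma mu_fin (A : set X) : measurable A -> mu A \is a fin_num.
Proof. by move=> mA; exact: fin_num_measure. Qed.

Lemma nonatomic_halving (A : set X) : measurable A -> 0 < mu A ->
  exists B, [/\ measurable B, 0 < mu B & mu B + mu B <= mu A].
Proof.
move=> mA A0; apply: contrapT => h; apply: (noatom (A := A)); split => // B mB BA.
have mAB : measurable (A `\` B) by exact: measurableD.
have AE : mu A = mu B + mu (A `\` B).
  rewrite -measureU//; last by rewrite setDIK.
  by rewrite setDUK.
have [|B0] := leP (mu B) 0; first by rewrite measure_le0 => /eqP; left.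
have [|D0] := leP (mu (A `\` B)) 0.
  by rewrite measure_le0 => /eqP D0; right; rewrite AE D0 adde0.
exfalso; apply: h; have [BD|DB] := leP (mu B) (mu (A `\` B)).
- by exists B; split => //; rewrite AE leeD2l.
- by exists (A `\` B); split => //; rewrite AE leeD2r// ltW.
Qed.

(** Iterated halving: after [n] steps the measure is at most [2^-n], and
    [n < 2^n]. *)
Lemma nonatomic_small_set (e : R) : (0 < e)%R ->
  exists B, [/\ measurable B, 0 < mu B & mu B <= e%:E].
Proof.
move=> e0.
have [n] : exists n, (0 + n.+1%:R^-1 < e)%R by exact: ltr_add_invr.
rewrite add0r => ne.
suff [B [mB B0 Bn]] : exists B, [/\ measurable B, 0 < mu B & (2 ^ n)%:R%:E * mu B <= 1].
  exists B; split => //; have Bf := mu_fin mB.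
  move: Bn; rewrite -(fineK Bf) -EFinM !lee_fin => Bn.
  apply: le_trans (ltW ne); rewrite -[leRHS]mul1r ler_pdivlMr ?ltr0n//.
  apply: le_trans Bn; rewrite mulrC ler_wpM2r ?fine_ge0// ler_nat.
  exact: ltn_expl.
elim: n {ne} => [|n [B [mB B0 Bn]]].
  by exists setT; rewrite expn0 probability_setT mule1; split.
have [C [mC C0 CB]] := nonatomic_halving mB B0.
exists C; split => //; apply: le_trans Bn.
rewrite expnSr natrM EFinM -muleA lee_wpmul2l ?lee_fin//.
by rewrite mule_natl mule2n.
Qed.

End small_sets.

(** * Neighbourhoods along the orbits *)

Section neighbourhoods.
Context d (X : measurableType d) (R : realType) (mu : probability X R).
Variable t : mpbij mu.
Implicit Types (B : set X) (p q : nat).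

Definition orbit_nbhd B p : set X :=
  [set x | exists2 n : int, (`|n| <= p)%N & B (mpbij_iter t n x)].

Lemma orbit_nbhd_measurable B p : measurable B -> measurable (orbit_nbhd B p).
Proof.
move=> mB.
have -> : orbit_nbhd B p = \bigcup_(n in [set: int])
    if (`|n| <= p)%N then mpbij_iter t n @^-1` B else set0.
  apply/seteqP; split => [x [n np Bn]|x [n _]]; first by exists n; rewrite ?np.
  by case: ifP => // np Bn; exists n.
apply: countable_bigcupT_measurable => // n; case: ifP => // _.
exact: mpbij_iter_measurable.
Qed.

Lemma mu_le (A C : set X) : measurable A -> measurable C -> A `<=` C ->
  (mu A <= mu C)%E.
Proof. by move=> mA mC AC; apply: le_measure; rewrite ?inE. Qed.

Lemma mu_le_U3 (D A B C : set X) : measurable D -> measurable A ->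
  measurable B -> measurable C -> (forall x, D x -> [\/ A x, B x | C x]) ->
  (mu D <= mu A + mu B + mu C)%E.
Proof.
move=> mD mA mB mC sub; have mAB : measurable (A `|` B) by exact: measurableU.
apply: le_trans (mu_le mD (measurableU _ _ mAB mC) _) _.
  by move=> x /sub[]; [left; left|left; right|right].
apply: le_trans (measureU2 _ mAB mC) _.
by rewrite leeD2r// measureU2.
Qed.

Lemma mu_orbit_nbhd_le B p : measurable B ->
  (mu (orbit_nbhd B p) <= (2 * p + 1)%:R%:E * mu B)%E.
Proof.
move=> mB; elim: p => [|p IH].
  rewrite muln0 add0n mul1e; apply: mu_le => //; first exact: orbit_nbhd_measurable.
  by move=> x [n]; rewrite leqn0 absz_eq0 => /eqP ->.
have mN := orbit_nbhd_measurable.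
apply: (@le_trans _ _ (mu (orbit_nbhd B p) + mu (mpbij_iter t p.+1 @^-1` B) +
                       mu (mpbij_iter t (- p.+1%:Z) @^-1` B))%E).
  apply: mu_le_U3; [exact: mN|exact: mN|exact: mpbij_iter_measurable..|].
  move=> x [n np Bn].
  have [np'|np'] := leqP `|n| p; first by constructor 1; exists n.
  have [nE|nE] : n = p.+1%:Z \/ n = - p.+1%:Z by lia.
    by constructor 2; rewrite nE in Bn.
  by constructor 3; rewrite nE in Bn.
rewrite !mpbij_iter_preserving//.
rewrite (_ : (2 * p.+1 + 1)%:R%:E = (2 * p + 1)%:R%:E + 1%:E + 1%:E)%E; last first.
  by rewrite -!EFinD; congr EFin; rewrite !natrD !natrM -natr1; lra.
by rewrite !ge0_muleDl ?lee_fin ?mul1e ?addr_ge0// leeD// leeD.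
Qed.

(** The neighbourhood of radius [p + q] is covered by the one of radius [p] and
    its translates by [T^q] and [T^-q]; the bound on [q] is what makes the three
    intervals cover without a gap. *)
Lemma mu_orbit_nbhd_triple B p q : measurable B -> (q <= 2 * p + 1)%N ->
  (mu (orbit_nbhd B (p + q)) <= 3%:R%:E * mu (orbit_nbhd B p))%E.
Proof.
move=> mB qp; have mN r := orbit_nbhd_measurable r mB.
apply: (@le_trans _ _ (mu (orbit_nbhd B p) +
    mu (mpbij_iter t q @^-1` orbit_nbhd B p) +
    mu (mpbij_iter t (- q%:Z) @^-1` orbit_nbhd B p))%E).
  apply: mu_le_U3 => //; [exact: mpbij_iter_measurable..|].
  move=> x [n npq Bn].
  have [np|np] := leqP `|n| p; first by constructor 1; exists n.
  have [nn|nn] : (absz (n - q%:Z)%R <= p)%N \/ (absz (n + q%:Z)%R <= p)%N by lia.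
    constructor 2; exists (n - q%:Z) => //.
    by rewrite -mpbij_iterD subrK.
  constructor 3; exists (n + q%:Z) => //.
  by rewrite -mpbij_iterD addrK.
rewrite !mpbij_iter_preserving// mule_natl.
by rewrite -[leRHS]/(_ + (_ + _))%E addeA.
Qed.

Hypothesis erg : mpbij_ergodic t.

Lemma mu_bigcup_orbit_nbhd B : measurable B -> (0 < mu B)%E ->
  mu (\bigcup_p orbit_nbhd B p) = 1%E.
Proof.
move=> mB B0; have mU : measurable (\bigcup_p orbit_nbhd B p).
  by apply: bigcupT_measurable => p; exact: orbit_nbhd_measurable.
have [|U0|//] := erg mU.
  move=> x [p _ [n np Bn]] _ [m _ <-]; exists (p + `|m|)%N => //.
  exists (n - m); first lia.
  by rewrite -mpbij_iterD subrK.
move: B0; rewrite ltNge => /negP[]; rewrite -U0; apply: mu_le => // x Bx.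
by exists 0%N => //; exists 0.
Qed.

Lemma orbit_nbhd_large B (e : R) : measurable B -> (0 < mu B)%E -> e < 1 ->
  exists p, (e%:E <= mu (orbit_nbhd B p))%E.
Proof.
move=> mB B0 e1; apply: contrapT => h.
have he p : (mu (orbit_nbhd B p) <= e%:E)%E.
  by rewrite leNgt; apply/negP => /ltW le; apply: h; exists p.
have mN r := orbit_nbhd_measurable r mB.
have : (mu (\bigcup_p orbit_nbhd B p) <= e%:E)%E.
  have cv : (mu \o orbit_nbhd B) x @[x --> \oo] --> mu (\bigcup_p orbit_nbhd B p).
    apply: nondecreasing_cvg_mu => //; first exact: bigcupT_measurable.
    move=> p q pq; apply/subsetPset => x [n np Bn]; exists n => //.
    exact: leq_trans pq.
  rewrite -(cvg_lim _ cv)//; apply: lime_le; first by apply/cvg_ex; eexists; exact: cv.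
  exact: nearW.
by rewrite mu_bigcup_orbit_nbhd// lee_fin leNgt e1.
Qed.

Hypothesis noatom : forall A, ~ is_atom mu A.

(** Slow growth of the neighbourhoods: [n] is the first radius at which the
    measure reaches [e / 9].  Tripling from [n - 1] to [n] and from [n] to [2n]
    keeps it at most [e], and since it is at most [(2n + 1) mu B], the radius [n]
    is large when [B] is small. *)
Lemma ergodic_bump (e M : R) : 0 < e -> e < 1 -> exists B (n : nat),
  [/\ measurable B, (mu (orbit_nbhd B (2 * n)) <= e%:E)%E &
      (M%:E <= n%:R%:E * mu (orbit_nbhd B n))%E].
Proof.
move=> e0 e1; set s := e / 9; have s0 : 0 < s by rewrite /s; lra.
have s1 : s < 1 by rewrite /s; lra.
(* [mu B <= s / K] and [s <= (2n + 1) mu B] give [K <= 2n + 1], that is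
   [|M| <= n s]. *)
pose K : R := 2 * (`|M| / s) + 1; have M0 : 0 <= `|M| / s by rewrite divr_ge0// ltW.
have K0 : 0 < K by rewrite /K; lra.
have sK : 0 < Num.min s (s / K) by rewrite lt_min s0 divr_gt0.
have [B [mB B0]] := nonatomic_small_set noatom sK.
have Bf := mu_fin mu mB.
rewrite -{1}(fineK Bf) lee_fin le_min => /andP[Bs BK].
have mN r := orbit_nbhd_measurable r mB.
have [m mE] : exists m : nat -> R, forall r, mu (orbit_nbhd B r) = (m r)%:E.
  exists (fun r => fine (mu (orbit_nbhd B r))) => r.
  by rewrite fineK//; exact: mu_fin.
have : exists r, s <= m r.
  by have [r] := orbit_nbhd_large mB B0 s1; rewrite mE lee_fin; exists r.
move=> /ex_minnP[n sn nmin]; exists B, n; rewrite !mE.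
have triple p q : (q <= 2 * p + 1)%N -> m (p + q)%N <= 3 * m p.
  by move=> /(mu_orbit_nbhd_triple mB); rewrite !mE -EFinM lee_fin.
have lin : m n <= (2 * n + 1)%:R * fine (mu B).
  by have := mu_orbit_nbhd_le n mB; rewrite mE -{1}(fineK Bf) -EFinM lee_fin.
have m3 : m n <= 3 * s.
  case: n sn nmin lin => [|n] sn nmin lin.
    by apply: le_trans lin _; rewrite mul1r; lra.
  have mn : m n <= s by rewrite leNgt; apply/negP => /ltW /nmin; rewrite ltnn.
  have tr : m (n + 1)%N <= 3 * m n by apply: triple; exact: leq_addl.
  by rewrite addn1 in tr; lra.
split => //.
  have tr : m (n + n)%N <= 3 * m n by apply: triple; rewrite mul2n -addnn -addnA leq_addr.
  by rewrite addnn -mul2n in tr; rewrite lee_fin; rewrite /s in m3; lra.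
rewrite -EFinM lee_fin; apply: le_trans (ler_norm M) _.
have nK : K <= (2 * n + 1)%:R.
  rewrite -(ler_pM2l s0); apply: (@le_trans _ _ ((2 * n + 1)%:R * (s / K) * K)); last first.
    by rewrite -mulrA divfK ?gt_eqF// mulrC.
  rewrite ler_pM2r//; apply: le_trans sn (le_trans lin _).
  by rewrite ler_wpM2l.
have : `|M| / s <= n%:R by move: nK; rewrite /K natrD natrM; lra.
rewrite ler_pdivrMr// => /le_trans; apply.
by rewrite ler_wpM2l.
Qed.

End neighbourhoods.

(** * A non-integrable function that is Lipschitz along the orbits *)

Section lipschitz.
Context d (X : measurableType d) (R : realType) (mu : probability X R).
Variable t : mpbij mu.

Definition orbit_lipschitz (phi : X -> \bar R) :=
  forall n x, (phi (mpbij_iter t n x) <= phi x + `|n|%:~R%:E)%E.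

Section cones.
Variables (B : (set X)^nat) (L : nat -> int).

(** The upper envelope of the cones of slope 1 whose vertices, of height [L k],
    are at the points of [B k].  The value 0 is put in the set to make the
    function nonnegative. *)
Definition sup_cones (x : X) : \bar R := ereal_sup
  [set r | r = 0%E \/
    exists k, exists2 i : int, B k (mpbij_iter t i x) & r = (L k - `|i|)%:~R%:E].

Lemma sup_cones_ge0 x : (0 <= sup_cones x)%E.
Proof. by apply: ereal_sup_ubound; left. Qed.

Lemma sup_cones_ge k i x : B k (mpbij_iter t i x) ->
  ((L k - `|i|)%:~R%:E <= sup_cones x)%E.
Proof. by move=> Bx; apply: ereal_sup_ubound; right; exists k, i. Qed.

Lemma sup_cones_lipschitz : orbit_lipschitz sup_cones.
Proof.
move=> m x; apply: ge_ereal_sup => _ [->|[k [i Bx ->]]].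
  by rewrite adde_ge0 ?sup_cones_ge0// lee_fin ler0z.
rewrite -mpbij_iterD in Bx.
apply: le_trans (leeD2r _ (sup_cones_ge Bx)).
by rewrite -EFinD lee_fin -rmorphD/= ler_int; lia.
Qed.

Lemma sup_cones_le0 x :
  (forall k i, B k (mpbij_iter t i x) -> L k <= `|i|) -> (sup_cones x <= 0)%E.
Proof.
move=> far; apply: ge_ereal_sup => _ [->//|[k [i /far Li ->]]].
by rewrite lee_fin lerz0 subr_le0.
Qed.

End cones.

Hypothesis erg : mpbij_ergodic t.
Hypothesis noatom : forall A, ~ is_atom mu A.

(** The cones of the [k]-th bump contribute at least [k] to the integral, and
    are supported in a set of measure at most [2^-(k+2)], so that their union
    has measure at most [1/2]. *)
Lemma exists_nonintegrable_lipschitz : exists phi : X -> \bar R,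
  [/\ orbit_lipschitz phi,
      ~ L1_bounded mu (fun x r => phi x <= r)%E &
      exists Z, [/\ measurable Z, (0 < mu Z)%E & forall x, Z x -> phi x = 0%E]].
Proof.
have bump k : exists Bn : set X * nat,
    [/\ measurable Bn.1,
        (mu (orbit_nbhd t Bn.1 (2 * Bn.2)) <= (2^-1 / (2 ^ k.+1)%:R)%:E)%E &
        (k%:R%:E <= Bn.2%:R%:E * mu (orbit_nbhd t Bn.1 Bn.2))%E].
  have k2 : 1 <= (2 ^ k.+1)%:R :> R by rewrite ler1n expn_gt0.
  have [||B [n [mB Bn Mn]]] := @ergodic_bump _ _ _ _ _ erg noatom
      (2^-1 / (2 ^ k.+1)%:R) k%:R.
  - by rewrite divr_gt0// (lt_le_trans _ k2).
  - rewrite ltr_pdivrMr ?(lt_le_trans _ k2)//; lra.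
  - by exists (B, n).
have {bump} [f /all_and3[mB small large]] := choice bump.
pose B k := (f k).1; pose n k := (f k).2.
pose phi := sup_cones B (fun k => (2 * n k)%:Z).
have mN k p : measurable (orbit_nbhd t (B k) p).
  by apply: orbit_nbhd_measurable; exact: mB.
have mU : measurable (\bigcup_k orbit_nbhd t (B k) (2 * n k)).
  exact: bigcupT_measurable.
exists phi; split.
- exact: sup_cones_lipschitz.
- move=> [h [mh h0 hoo phih]].
  (* Within distance [n k] of a vertex, at least half of the height [2 n k] of
     the cone is left. *)
  have hk k : (k%:R%:E <= \int[mu]_x h x)%E.
    apply: le_trans (large k) _; rewrite -/(B k) -/(n k).
    have -> : mu (orbit_nbhd t (B k) (n k)) =
        (\int[mu]_x (\1_(orbit_nbhd t (B k) (n k)) x)%:E)%E.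
      by rewrite integral_indic// setIT.
    have mi : measurable_fun setT
        (fun x => (\1_(orbit_nbhd t (B k) (n k)) x)%:E : \bar R).
      exact/measurable_EFinP/measurable_indic.
    rewrite -ge0_integralZl//.
    apply: ae_ge0_le_integral => //.
      exact: emeasurable_funM.
    apply: filterS phih => x phix _; rewrite indicE.
    case: (boolP (x \in _)) => [/set_mem[i ik Bi]|_]; last by rewrite mule0.
    rewrite mule1; apply: le_trans (le_trans _ (sup_cones_ge _ Bi)) phix.
    rewrite lee_fin -[leLHS]/((n k)%:Z%:~R) ler_int.
    by move: (n k) ik; clear; lia.
  have hf : (\int[mu]_x h x)%E \is a fin_num.
    by rewrite ge0_fin_numE// integral_ge0.
  have [k] : exists k : nat, fine (\int[mu]_x h x)%E < k%:R.
    exists (Num.bound (fine (\int[mu]_x h x)%E)).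
    by apply: archi_boundP; rewrite fine_ge0// integral_ge0.
  by have := hk k; rewrite -(fineK hf) lee_fin leNgt => /negP.
- exists (~` \bigcup_k orbit_nbhd t (B k) (2 * n k)); split.
  + exact: measurableC.
  + rewrite probability_setC// sube_gt0.
    apply: (@le_lt_trans _ _ (2^-1)%:E); last by rewrite lte_fin; lra.
    apply: le_trans (measure_sigma_subadditive mu _ mU (@subset_refl _ _)) _ => //.
    apply: le_trans (lee_nneseries _ _) (epsilon_trick0 xpredT _) => //.
      by move=> k _; exact: small.
  + move=> x nx; apply/eqP; rewrite eq_le; apply/andP; split; last exact: sup_cones_ge0.
    apply: sup_cones_le0 => k i Bi; rewrite leNgt; apply/negP => ik.
    apply: nx; exists k => //; exists i => //.
    by move: (n k) ik; clear; lia.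
Qed.

End lipschitz.

(** * Aperiodicity *)

Section aperiodic.
Context d (X : measurableType d) (R : realType) (mu : probability X R).
Variable t : mpbij mu.

Lemma mpbij_iter_period p x : mpbij_iter t p x = x ->
  forall q : int, mpbij_iter t (q * p) x = x.
Proof.
move=> px; have pos (k : nat) : mpbij_iter t (k%:Z * p) x = x.
  elim: k => [|k IH]; first by rewrite mul0r.
  by rewrite intS mulrDl mul1r mpbij_iterD IH.
case=> k; first exact: pos.
by rewrite NegzE mulNr -{1}(pos k.+1) mpbij_iterK.
Qed.

Variable O : (set X)^nat.
Hypothesis sepO : separating O.
Hypothesis erg : mpbij_ergodic t.
Hypothesis noatom : forall A, ~ is_atom mu A.

(** If the points of period dividing [p] had positive measure, they would by
    ergodicity have full measure.  Almost every orbit would then meet a given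
    set [B] of positive measure within [p] steps, which is impossible when
    [(2p + 1) mu B < 1]. *)
Lemma ergodic_aperiodic :
  {ae mu, forall x, forall p : int, mpbij_iter t p x = x -> p = 0}.
Proof.
suff ape (p : nat) : {ae mu, forall x, mpbij_iter t p.+1%:Z x <> x}.
  have {}ape := ae_foralln ape; apply: filterS ape => x ape [[|p]|p] //.
    by move=> /ape.
  by rewrite NegzE -mulN1r => /mpbij_iter_period /(_ (-1)); rewrite mulN1r mulN1r opprK => /ape.
pose P : set X := [set x | mpbij_iter t p.+1 x = x].
have mP : measurable P.
  rewrite -[P]setCK; apply: measurableC.
  exact: (separating_neq_measurable sepO (mpbij_iter_measurable_fun t p.+1)
     (@measurable_id _ _ _)).
suff P0 : mu P = 0%E by exists P; split => // x /= /contrapT.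
have [|//|P1] := erg mP.
  by move=> x Px _ [n _ <-]; rewrite /P /mkset mpbij_iterC Px.
exfalso; pose K : R := (2 * p.+1 + 1)%:R.
have K0 : 0 < K by rewrite ltr0n addn1.
have K20 : 0 < 2^-1 / K by rewrite divr_gt0.
have [B [mB B0 BK]] := nonatomic_small_set noatom K20.
have U1 := mu_bigcup_orbit_nbhd erg mB B0.
have mN r := orbit_nbhd_measurable t r mB.
set U := \bigcup_p _ in U1; have mU : measurable U by exact: bigcupT_measurable.
have : (mu P <= K%:E * mu B + 0)%E.
  have <- : mu (~` U) = 0%E by rewrite probability_setC// U1 subee.
  have mCU := measurableC mU.
  apply: le_trans (leeD2r _ (mu_orbit_nbhd_le t p.+1 mB)).
  apply: le_trans (measureU2 _ (mN p.+1) mCU).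
  apply: mu_le => //; first exact: measurableU.
  move=> x Px; have [[r _ [i _ Bi]]|nU] := pselect (U x); last by right.
  left; exists (i %% p.+1%:Z)%Z; first lia.
  by rewrite -(mpbij_iter_period Px (i %/ p.+1%:Z)%Z) -mpbij_iterD addrC -divz_eq.
rewrite adde0 P1 => /le_trans /(_ (lee_wpmul2l _ BK)).
rewrite -EFinM !lee_fin mulrC divfK ?gt_eqF// => /(_ (ltW K0)); lra.

Qed.

End aperiodic.

(** * The L1 full group *)

Section L1_membership.
Context d (X : measurableType d) (R : realType) (mu : probability X R).

(** Used for the modulus of a cocycle, whose level sets are known. *)
Lemma nat_valued_measurable_fun d' (Y : measurableType d') (v : X -> nat)
  (F : nat -> Y) :
  (forall k, measurable (v @^-1` [set k])) -> measurable_fun setT (F \o v).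
Proof.
move=> mv _ A mA; rewrite setTI.
have -> : (F \o v) @^-1` A =
    \bigcup_(k in [set k | A (F k)]) (v @^-1` [set k]).
  by apply/seteqP; split => [x /= Ax|x [k Ak /= vk]]; [exists (v x)|rewrite /= vk].
by apply: bigcup_measurable.
Qed.

Variables (T : Aut mu) (O : (set X)^nat).
Hypothesis sepO : separating O.
Hypothesis aperiodic :
  {ae mu, forall x, forall p : int, mpbij_iter T p x = x -> p = 0}.

(** Aperiodicity makes the exponent unique, hence equal to the one selected by
    the cocycle. *)
Lemma ae_cocycleP (U : Aut mu) : full_group T U ->
  {ae mu, forall x, forall n : int, U x = mpbij_iter T n x <-> n = cocycle T U x}.
Proof.
move=> fU; apply: filterS2 aperiodic fU => x ape [n0 _ n0U].
have cU : U x = mpbij_iter T (cocycle T U x) x.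
  by apply: (xgetPex 0 (P := [set n | U x = mpbij_iter T n x])); exists n0.
move=> n; split=> [Un|->//]; apply/eqP; rewrite -subr_eq0; apply/eqP/ape.
by rewrite addrC mpbij_iterD -Un cU mpbij_iterK.
Qed.

(** The cocycle is measurable away from a null set [N].  Replacing it on [N] by
    0 (first direction), or its dominating function by [+oo] (second direction),
    changes no integral. *)
Lemma L1_full_groupP (U : Aut mu) : L1_full_group T U <-> L1_displacement T U.
Proof.
split=> [[fU ioo]|LU].
- have [N [mN N0 cN]] := ae_cocycleP fU.
  have {}cN x : ~ N x -> forall n, U x = mpbij_iter T n x <-> n = cocycle T U x.
    by move=> Nx; apply: contrapT => h; apply: Nx; exact: cN.
  pose v x := if x \in N then 0%N else absz (cocycle T U x).
  have mE n : measurable [set x | U x = mpbij_iter T n x].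
    rewrite -[[set x | _]]setCK; apply: measurableC.
    exact: (separating_neq_measurable sepO (mpbij_measurable U)
      (mpbij_iter_measurable_fun T n)).
  have mv k : measurable (v @^-1` [set k]).
    have -> : v @^-1` [set k] = (N `&` [set x | 0%N = k]) `|`
        (~` N `&` ([set x | U x = mpbij_iter T k x] `|`
                   [set x | U x = mpbij_iter T (- k%:Z) x])).
      apply/seteqP; split => [x|x]; rewrite /v /preimage /=.
        case: (boolP (x \in N)) => [/set_mem Nx <-|/negP Nx]; first by left.
        have {}Nx : ~ N x by move=> /mem_set.
        move=> ck; right; split => //.
        have [h|h] : k%:Z = cocycle T U x \/ - k%:Z = cocycle T U x by lia.
          by left; exact: (cN x Nx k%:Z).2 h.
        by right; exact: (cN x Nx (- k%:Z)).2 h.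
      case=> [[Nx k0]|[Nx h]]; first by rewrite mem_set.
      by rewrite memNset//; case: h => [/(cN x Nx k%:Z)|/(cN x Nx (- k%:Z))] <-; lia.
    apply: measurableU; apply: measurableI => //.
    - by have [->|k0] := eqVneq 0%N k; [rewrite (_ : [set _ | _] = setT)//; apply/seteqP|
        rewrite (_ : [set _ | _] = set0)//; apply/seteqP; split => // x /= /eqP; rewrite (negbTE k0)].
    - exact: measurableC.
    - exact: measurableU.
  exists (fun x => (v x)%:R%:E); split => //.
  + exact: (@nat_valued_measurable_fun _ _ v (fun k => k%:R%:E) mv).
  + apply: le_lt_trans ioo; apply: integral_le_nonmeasurable => // x.
    by rewrite lee_fin /v; case: ifP => _; rewrite ?ler0z -?pmulrn// -abszE.
  + exists N; split => // x /=; apply: contra_notP => Nx.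
    exists (cocycle T U x); first exact: (cN x Nx _).2 erefl.
    by rewrite /v memNset// lee_fin -abszE -pmulrn.
- have fU : full_group T U.
    by move: LU => [h [_ _ _]]; apply: filterS => x [n Un _]; exists n.
  split => //; move: LU => [h [mh h0 hoo Uh]].
  have [N [mN N0 cN]] : {ae mu, forall x, (`|cocycle T U x|%:~R%:E <= h x)%E}.
    apply: filterS2 Uh (ae_cocycleP fU) => x [n Un nh] cx.
    by rewrite -((cx n).1 Un).
  have mh' : measurable_fun setT (fun x => if x \in N then +oo%E else h x).
    apply: measurable_fun_ifT => //.
    by apply: (measurable_fun_bool true); rewrite setTI preimage_mem_true.
  apply: le_lt_trans hoo.
  apply: (@le_trans _ _ (\int[mu]_x (if x \in N then +oo%E else h x)))%E.
    apply: integral_le_nonmeasurable => x; first by rewrite lee_fin ler0z.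
    case: (boolP (x \in N)) => [_|/negP Nx]; first by rewrite leey.
    by apply: contrapT => cx; apply: Nx; apply/mem_set/cN.
  rewrite le_eqVlt; apply/orP; left; apply/eqP; apply: ge0_ae_eq_integral => //.
    by move=> x _; case: ifP.
  exists N; split => // x /=; apply: contra_notP => Nx _.
  by rewrite memNset.
Qed.

Lemma L1_full_group_is_subgroup : is_subgroup (L1_full_group T).
Proof.
split=> [|U V].
  apply/L1_full_groupP/(L1_displacement_ae_eq _ (L1_displacement_id T)).
  by apply: filterS (Aut_oneE mu) => x ->.
move=> /L1_full_groupP LU /L1_full_groupP LV; apply/L1_full_groupP.
apply: (L1_displacement_ae_eq _
  (L1_displacement_comp LU (L1_displacement_sym LV))).
by apply: filterS (Aut_divE U V) => x ->.
Qed.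

End L1_membership.

(** * Exchanging a set with its image *)

Section swap.
Context d (X : measurableType d) (R : realType) (mu : probability X R).
Variables (t : mpbij mu) (E : set X).
Hypotheses (mE : measurable E) (Et : forall x, E x -> ~ E (t x)).

Definition swap x :=
  if x \in E then t x else if mpbij_inv t x \in E then mpbij_inv t x else x.

Let F := mpbij_inv t @^-1` E.

Lemma swap_in x : E x -> swap x = t x.
Proof. by move=> Ex; rewrite /swap mem_set. Qed.

Lemma swap_image x : E (mpbij_inv t x) -> swap x = mpbij_inv t x.
Proof.
move=> Ex; rewrite /swap memNset ?mem_set//.
by move=> Ex'; apply: (Et Ex); rewrite mpbij_invK.
Qed.

Lemma swap_out x : ~ E x -> ~ E (mpbij_inv t x) -> swap x = x.
Proof. by move=> nE nF; rewrite /swap !memNset. Qed.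

Lemma swapK : involutive swap.
Proof.
move=> x; have [Ex|nE] := pselect (E x).
  by rewrite [swap x]swap_in// swap_image mpbij_funK.
have [Fx|nF] := pselect (E (mpbij_inv t x)).
  by rewrite [swap x]swap_image// swap_in// mpbij_invK.
by rewrite [swap x]swap_out// swap_out.
Qed.

Let mF : measurable F.
Proof. exact: (mpbij_measurable_preimage (mpbij_sym t)). Qed.

Let EF0 x : E x -> F x -> False.
Proof. by move=> Ex /Et; rewrite mpbij_invK. Qed.

Let swap_preimageE A : E `&` swap @^-1` A = t @^-1` (F `&` A).
Proof.
apply/seteqP; split=> x; rewrite /preimage /mkset /setI /mkset /F /preimage /mkset mpbij_funK.
  by move=> [Ex]; rewrite swap_in.
by move=> [Ex Ax]; split => //; rewrite swap_in.
Qed.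

Let swap_preimageF A : F `&` swap @^-1` A = mpbij_inv t @^-1` (E `&` A).
Proof.
apply/seteqP; split=> x; rewrite /preimage /mkset /setI /mkset /F /preimage /mkset.
  by move=> [Ex]; rewrite swap_image.
by move=> [Ex Ax]; split => //; rewrite swap_image.
Qed.

Let swap_preimageC A : ~` (E `|` F) `&` swap @^-1` A = ~` (E `|` F) `&` A.
Proof.
by apply/seteqP; split=> x [nEF Ax]; split => //; move: Ax;
  rewrite /preimage /mkset swap_out// => h; apply: nEF; [left|right|left|right].
Qed.

Let split3 A : A = (E `&` A) `|` ((F `&` A) `|` (~` (E `|` F) `&` A)).
Proof. by rewrite -!setIUl setUA setUCr setTI. Qed.

Lemma swap_measurable : measurable_fun setT swap.
Proof.
move=> _ A mA; rewrite setTI (split3 (swap @^-1` A)).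
rewrite swap_preimageE swap_preimageF swap_preimageC.
apply: measurableU; first by apply: mpbij_measurable_preimage; exact: measurableI.
apply: measurableU.
  by apply: (mpbij_measurable_preimage (mpbij_sym t)); exact: measurableI.
by apply: measurableI => //; apply: measurableC; exact: measurableU.
Qed.

Let mu_split3 A : measurable A ->
  mu A = (mu (E `&` A) + (mu (F `&` A) + mu (~` (E `|` F) `&` A)))%E.
Proof.
move=> mA; have mC : measurable (~` (E `|` F) `&` A).
  by apply: measurableI => //; apply: measurableC; exact: measurableU.
have mEA : measurable (E `&` A) by exact: measurableI.
have mFA : measurable (F `&` A) by exact: measurableI.
rewrite {1}[A]split3 measureU//; [|exact: measurableU|].
  congr (_ + _)%E; rewrite measureU// -subset0 => x [[Fx _] [nEF _]].
  by apply: nEF; right.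
rewrite -subset0 => x [[Ex _] [[Fx _]|[nEF _]]]; first exact: (EF0 Ex Fx).
by apply: nEF; left.
Qed.

(** [t] and its inverse exchange the part of [swap @^-1` A] in [E] with the part
    of [A] in [t E] and vice versa, and [swap] is the identity elsewhere. *)
Lemma swap_preserving A : measurable A -> mu (swap @^-1` A) = mu A.
Proof.
move=> mA; have msA : measurable (swap @^-1` A).
  by rewrite -[X in measurable X]setTI; exact: swap_measurable.
rewrite (mu_split3 msA) (mu_split3 mA).
rewrite swap_preimageE swap_preimageF swap_preimageC.
rewrite mpbij_preserving; last exact: measurableI.
rewrite (mpbij_preserving (mpbij_sym t)); last exact: measurableI.
by rewrite addeCA.
Qed.

Definition mpbij_swap : mpbij mu :=
  Mpbij swapK swapK swap_measurable swap_measurable swap_preserving.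

Lemma L1_displacement_swap : L1_displacement t mpbij_swap.
Proof.
apply: (@L1_bounded_cst _ _ _ _ 1) => //; apply: aeW => x.
have [Ex|nE] := pselect (E x); first by exists 1 => //=; rewrite swap_in.
have [Fx|nF] := pselect (E (mpbij_inv t x)).
  by exists (-1) => //=; rewrite swap_image.
by exists 0 => //=; rewrite ?swap_out// lee_fin.
Qed.

End swap.

(** * Three-cycles in the derived group *)

Section three_cycles.
Context d (X : measurableType d) (R : realType) (mu : probability X R).
Variables (T : Aut mu) (O : (set X)^nat).
Hypothesis sepO : separating O.
Hypothesis aperiodic :
  {ae mu, forall x, forall p : int, mpbij_iter T p x = x -> p = 0}.

(** The sets [E], [T E] and [T^2 E] are disjoint, that is, [E] is the base of a
    tower of height 3.  Negative [n] are included so that the condition is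
    symmetric in the two points. *)
Definition spaced (E : set X) := measurable E /\
  forall (n : int) x, (0 < `|n| <= 2)%N -> E x -> ~ E (mpbij_iter T n x).

Lemma L1_pi (f : mpbij mu) : L1_displacement T f ->
  L1_full_group T (\pi_(Aut mu) f)%qT.
Proof.
move=> Lf; apply/(L1_full_groupP sepO aperiodic).
apply: L1_displacement_ae_eq Lf.
by apply: filterS (Aut_repr_pi f) => x ->.
Qed.

(** The commutator of the transpositions (1 2) and (2 3) is a 3-cycle. *)
Lemma three_cycle_in_derived (E : set X) : spaced E -> exists W : Aut mu,
  [/\ derived_subgroup (L1_full_group T) W,
      {ae mu, forall x, E x -> W x <> x} &
      {ae mu, forall x, W x <> x ->
         exists2 n : int, (`|n| <= 2)%N & E (mpbij_iter T n x)}].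
Proof.
move=> [mE sE]; pose F := mpbij_inv T @^-1` E.
have mF : measurable F by exact: (mpbij_measurable_preimage (mpbij_sym T)).
have Et x : E x -> ~ E (T x) by exact: (sE 1).
have Ett x : E x -> ~ E (T (T x)) by exact: (sE 2).
have Ft x : F x -> ~ F (T x).
  by rewrite /F /preimage /mkset mpbij_funK => /Et; rewrite mpbij_invK.
pose a := mpbij_swap mE Et; pose b := mpbij_swap mF Ft.
exists (commg (\pi_(Aut mu) a)%qT (\pi_(Aut mu) b)%qT).
have WE : {ae mu, forall x,
    (commg (\pi_(Aut mu) a)%qT (\pi_(Aut mu) b)%qT : Aut mu) x = a (b (a (b x)))}.
  have -> : commg (\pi_(Aut mu) a)%qT (\pi_(Aut mu) b)%qT = \pi_(Aut mu)%qT
      (mpbij_comp (mpbij_sym a) (mpbij_comp (mpbij_sym b) (mpbij_comp a b))).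
    by rewrite -!pi_mpbij_comp -!pi_mpbij_sym.
  exact: Aut_repr_pi.
split.
- by apply: derived_subgroup_commg; apply: L1_pi; exact: L1_displacement_swap.
- apply: filterS WE => x -> Ex.
  have nF : ~ F x by rewrite /F => /Et; rewrite mpbij_invK.
  have nFi : ~ F (mpbij_inv T x) by rewrite /F => /Ett; rewrite !mpbij_invK.
  rewrite /= [swap _ F x]swap_out// [swap _ E x]swap_in//.
  rewrite [swap _ F _]swap_in; last by rewrite /F /preimage /mkset mpbij_funK.
  rewrite swap_out; [|exact: Ett Ex|by rewrite mpbij_funK; exact (Et _ Ex)].
  by move=> Wx; apply: (Ett _ Ex); rewrite Wx.
- apply: filterS WE => x -> Wx; apply: contrapT => nE; apply: Wx.
  have nE0 : ~ E x by move=> Ex; apply: nE; exists 0.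
  have nE1 : ~ E (mpbij_inv T x) by move=> Ex; apply: nE; exists (-1).
  have nE2 : ~ F (mpbij_inv T x) by move=> Ex; apply: nE; exists (-2).
  by rewrite /= ![swap _ F x]swap_out// [swap _ E x]swap_out// swap_out// swap_out.
Qed.

End three_cycles.

(** * Existence of spaced sets *)

Section spaced_sets.
Context d (X : measurableType d) (R : realType) (mu : probability X R).
Variables (T : Aut mu) (O : (set X)^nat).
Hypothesis sepO : separating O.

(** If [O_i] contains [x] but not [T x], and [O_j] contains [x] but not [T^2 x],
    then the points with these properties form a spaced set
    containing [x]. *)
Lemma spaced_cover : exists F : (set X)^nat, (forall k, spaced T (F k)) /\
  forall x, T x <> x -> T (T x) <> x -> exists k, F k x.
Proof.
have [mO sO] := sepO.
pose p k : nat * nat := odflt (0%N, 0%N) (unpickle k).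
pose F k : set X := [set x | [/\ O (p k).1 x, ~ O (p k).1 (T x),
                                 O (p k).2 x & ~ O (p k).2 (T (T x))]].
exists F; split => [k|x Tx TTx]; last first.
  have [i Oi nOi] := sO _ _ (nesym Tx); have [j Oj nOj] := sO _ _ (nesym TTx).
  by exists (pickle (i, j)); rewrite /F /p pickleK.
split.
  have -> : F k = (O (p k).1 `&` ~` (T @^-1` O (p k).1)) `&`
      (O (p k).2 `&` ~` (mpbij_iter T 2 @^-1` O (p k).2)).
    by apply/seteqP; split=> x; [move=> []|move=> [[? ?] []]].
  apply: measurableI; apply: measurableI => //; apply: measurableC.
    exact: mpbij_measurable_preimage.
  exact: mpbij_iter_measurable.
have pos n x : n = 1 \/ n = 2 -> F k x -> ~ F k (mpbij_iter T n x).
  by case=> -> [_ n1 _ n2] [].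
move=> n x n2; have [|n0] := leP 0 n.
  by move=> n0; apply: pos; lia.
move=> Fx Fn; apply: (pos (- n) (mpbij_iter T n x)) => //; first lia.
by rewrite mpbij_iterK.
Qed.

(** Each step adds the points of the next set that are at distance more than 2
    from those already chosen, so that the union is spaced and maximal. *)
Fixpoint greedy (F : (set X)^nat) k : set X :=
  if k is j.+1 then greedy F j `|` (F j `\` orbit_nbhd T (greedy F j) 2) else set0.

Lemma greedy_spaced F : (forall k, spaced T (F k)) -> forall k, spaced T (greedy F k).
Proof.
move=> sF; elim=> [|k [mG sG]]; first by split=> [|n x _ []]; first exact: measurable0.
have mN := orbit_nbhd_measurable T 2 mG.
split => [|n x n2].
  by apply: measurableU => //; apply: measurableD => //; exact: (sF k).1.
move=> [Gx|[Fx Nx]] [Gn|[Fn Nn]].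
- exact: (sG n x).
- apply: Nn; exists (- n); first by rewrite abszN; lia.
  by rewrite mpbij_iterK.
- by apply: Nx; exists n => //; lia.
- exact: ((sF k).2 n x).
Qed.

Lemma greedy_homo F j k : (j <= k)%N -> greedy F j `<=` greedy F k.
Proof.
move=> /subnKC <-; elim: (k - j)%N => [|i IH]; first by rewrite addn0.
by rewrite addnS => x Gx; left; exact: IH.
Qed.

(** Maximality of the greedy choice: a point of [F k] that was not added at step
    [k] was rejected because it is within distance 2 of an earlier one. *)
Lemma exists_syndetic_spaced : exists2 E : set X, spaced T E &
  forall x, T x <> x -> T (T x) <> x -> orbit_nbhd T E 2 x.
Proof.
have [F [sF cF]] := spaced_cover; have sG := greedy_spaced sF.
exists (\bigcup_k greedy F k); first split.
- by apply: bigcupT_measurable => k; exact: (sG k).1.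
- move=> n x n2 [j _ Gj] [k _ Gk].
  apply: ((sG (maxn j k)).2 n x n2).
  + by apply: greedy_homo Gj; exact: leq_maxl.
  + by apply: greedy_homo Gk; exact: leq_maxr.
move=> x Tx /(cF x Tx)[k Fk].
have [[n n2 Gn]|nG] := pselect (orbit_nbhd T (greedy F k) 2 x).
  by exists n => //; exists k.
by exists 0 => //; exists k.+1 => //; right.
Qed.

Hypothesis aperiodic :
  {ae mu, forall x, forall p : int, mpbij_iter T p x = x -> p = 0}.

Let ae_moved : {ae mu, forall x, T x <> x /\ T (T x) <> x}.
Proof.
by apply: filterS aperiodic => x ape; split=> Tx;
  [have := ape 1 Tx|have := ape 2 Tx].
Qed.

Lemma exists_spaced_sub (Z : set X) : measurable Z -> (0 < mu Z)%E ->
  exists E, [/\ spaced T E, (0 < mu E)%E & E `<=` Z].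
Proof.
move=> mZ Z0; have [F [sF cF]] := spaced_cover.
apply: contrapT => h; have null k : mu (F k `&` Z) = 0%E.
  apply/eqP; rewrite eq_le measure_ge0 andbT leNgt; apply/negP => FZ.
  apply: h; exists (F k `&` Z); split; [|exact: FZ|exact: subIsetr].
  split; first by apply: measurableI => //; exact: (sF k).1.
  by move=> n x n2 [Fx _] [Fn _]; exact: ((sF k).2 n x n2).
have [N [mN N0 cN]] := ae_moved.
have mFZ k : measurable (F k `&` Z) by apply: measurableI => //; exact: (sF k).1.
have mU : measurable (\bigcup_k (F k `&` Z)) by exact: bigcupT_measurable.
have U0 : mu (\bigcup_k (F k `&` Z)) = 0%E.
  apply/eqP; rewrite eq_le measure_ge0 andbT.
  apply: le_trans (measure_sigma_subadditive mu mFZ mU (@subset_refl _ _)) _.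
  by rewrite eseries0 => [|k _ _]; [exact: lexx|exact: null].
move: Z0; rewrite ltNge => /negP[].
rewrite -(adde0 0%E) -{1}U0 -N0.
apply: le_trans (measureU2 _ mU mN).
apply: mu_le => //; first exact: measurableU.
move=> x Zx; have [[Tx TTx]|nT] := pselect (T x <> x /\ T (T x) <> x).
  by have [k Fk] := cF x Tx TTx; left; exists k.
by right; exact: cN.
Qed.

End spaced_sets.

(** * The normal subgroup of a Lipschitz function *)

Section normal_subgroup.
Context d (X : measurableType d) (R : realType) (mu : probability X R).
Variables (T : Aut mu) (O : (set X)^nat) (phi : X -> \bar R).
Hypothesis sepO : separating O.
Hypothesis aperiodic :
  {ae mu, forall x, forall p : int, mpbij_iter T p x = x -> p = 0}.
Hypothesis phi_lip : orbit_lipschitz T phi.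

(** Domination only where [U] moves the point amounts to integrability of [phi]
    on the support of [U], for any representative of [U]. *)
Definition L1_support : set (Aut mu) := [set U |
  L1_bounded mu (fun x r => U x <> x -> (phi x <= r)%E)].

Lemma L1_support_is_subgroup : is_subgroup L1_support.
Proof.
split=> [|U V NU NV].
  apply: (@L1_bounded_cst _ _ _ _ 0) => //.
  by apply: filterS (Aut_oneE mu) => x ->.
apply: (L1_boundedD NU NV); apply: filterS (Aut_divE U V) => x -> r s r0 s0 Ur Vs.
have [Vx|Vx] := pselect (Aut_repr V x = x).
  by rewrite -{1}Vx mpbij_funK => /Ur /le_trans; apply; rewrite leeDl.
by move=> _; apply: le_trans (Vs Vx) _; rewrite leeDr.
Qed.

(** If [V^-1 U V] moves [x], then [U] moves [V x], and [phi x] exceeds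
    [phi (V x)] by at most the displacement of [V], which is integrable. *)
Lemma L1_support_conjg (U V : Aut mu) :
  L1_full_group T V -> L1_support U -> L1_support (U ^ V)%g.
Proof.
move=> /(L1_full_groupP sepO aperiodic) LV NU.
apply: (L1_boundedD (L1_bounded_comp (Aut_repr V) NU) LV).
apply: filterS (Aut_conjE U V) => x -> r s r0 s0 Ur [n Vn ns] UV.
have UVx : U (V x) <> V x by move=> UVx; apply: UV; rewrite UVx mpbij_funK.
rewrite -(mpbij_iterK T n x) -Vn; apply: le_trans (phi_lip _ _) _.
by rewrite normrN; apply: leeD => //; exact: Ur.
Qed.

Lemma L1_support_spread (E : set X) (s : seq int) :
  L1_bounded mu (fun x r => E x -> (phi x <= r)%E) ->
  L1_bounded mu (fun x r => forall n, n \in s -> E (mpbij_iter T n x) ->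
    (phi (mpbij_iter T n x) <= r)%E).
Proof.
move=> LE; elim: s => [|m s IH].
  by apply: (@L1_bounded_cst _ _ _ _ 0) => //; exact: aeW.
apply: (L1_boundedD (L1_bounded_comp (mpbij_pow T m) LE) IH).
apply: aeW => x a b a0 b0 Ea IHb n.
rewrite inE => /predU1P[->|ns] En.
  by apply: le_trans (Ea En) _; rewrite leeDl.
by apply: le_trans (IHb n ns En) _; rewrite leeDr.
Qed.

(** If [T^n x] lies in [E] with [|n| <= p], then [phi x <= phi (T^n x) + p].
    Thus [phi] is dominated by [p] plus the sum of the finitely many translates
    of a function dominating [phi] on [E]. *)
Lemma L1_bounded_syndetic (E : set X) (p : nat) :
  {ae mu, forall x, orbit_nbhd T E p x} ->
  L1_bounded mu (fun x r => E x -> (phi x <= r)%E) ->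
  L1_bounded mu (fun x r => phi x <= r)%E.
Proof.
move=> syn LE.
pose s : seq int := [seq k%:Z | k <- iota 0 p.+1] ++ [seq - k%:Z | k <- iota 0 p.+1].
have sP n : (`|n| <= p)%N -> n \in s.
  move=> np; rewrite mem_cat; apply/orP.
  have [n0|n0] := leP 0 n; [left|right]; apply/mapP; exists (absz n);
    rewrite ?mem_iota; lia.
have Lp : L1_bounded mu (fun _ r => p%:R%:E <= r)%E.
  by apply: (@L1_bounded_cst _ _ _ _ p%:R) => //; apply: aeW.
apply: (L1_boundedD (L1_support_spread s LE) Lp).
apply: filterS syn => x [n np En] a b a0 b0 Ea pb.
rewrite -(mpbij_iterK T n x); apply: le_trans (phi_lip _ _) _.
apply: leeD; first by apply: Ea => //; exact: sP.
apply: le_trans pb; rewrite normrN lee_fin -[leRHS]/(p%:Z%:~R) ler_int; lia.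
Qed.

End normal_subgroup.

(** * Non-simplicity *)

Theorem theorem4p26 (R : realType) (d : measure_display)
    (X : measurableType d) (mu : probability X R) (T : Aut mu) :
  standard_probability_space mu -> ergodic T ->
  let D := derived_subgroup (L1_full_group T) in
  ~ is_simple D /\ ~ is_simple (L1_closure T D).
Proof.
move=> [sb noatom] erg D; have [S sepS] := standard_borel_separating sb.
have aperiodic := ergodic_aperiodic sepS erg noatom.
have [phi [phi_lip phi_notL1 [Z [mZ Z0 phiZ]]]] :=
  exists_nonintegrable_lipschitz erg noatom.
have gL := L1_full_group_is_subgroup sepS aperiodic.
have gD : is_subgroup D by exact: derived_subgroup_is_subgroup.
have gS := L1_support_is_subgroup mu phi.
pose N := D `&` L1_support phi.
have gN : is_subgroup N.
  split; first by split; [exact: gD.1|exact: gS.1].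
  by move=> U V [DU SU] [DV SV]; split; [exact: gD.2|exact: gS.2].
have NJ U V : L1_full_group T V -> N U -> N (U ^ V)%g.
  move=> LV [DU SU]; split; first exact: derived_subgroup_conjg.
  exact: (L1_support_conjg sepS aperiodic).
have [U NU U1] : exists2 U, N U & U <> 1%g.
  have [E [sE E0 EZ]] := exists_spaced_sub sepS aperiodic mZ Z0.
  have [U [DU EU UE]] := three_cycle_in_derived sepS aperiodic sE.
  exists U.
    split => //; apply: (@L1_bounded_cst _ _ _ _ 2) => //.
    apply: filterS UE => x Ux /Ux[n n2 En].
    rewrite -(mpbij_iterK T n x); apply: le_trans (phi_lip _ _) _.
    rewrite (phiZ _ (EZ _ En)) add0e lee_fin normrN.
    by rewrite -[leRHS]/(2%:Z%:~R) ler_int; lia.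
  move=> U1; have [A [mA A0 EA]] : {ae mu, forall x, ~ E x}.
    by rewrite U1 in EU; apply: filterS2 EU (Aut_oneE mu) => x Ex Ux /Ex.
  move: E0; rewrite ltNge -A0 => /negP; apply; apply: mu_le => //.
    exact: sE.1.
  by move=> x Ex; apply: EA => /= /(_ Ex).
have [W DW NW] : exists2 W, D W & ~ N W.
  have [E sE cE] := exists_syndetic_spaced T sepS.
  have [W [DW EW _]] := three_cycle_in_derived sepS aperiodic sE.
  exists W => // -[_ LW]; apply: phi_notL1.
  apply: (L1_bounded_syndetic phi_lip (E := E) (p := 2)).
    apply: filterS aperiodic => x ape.
    by apply: cE => Tx; [have := ape 1 Tx|have := ape 2 Tx].
  by apply: L1_bounded_mono LW _; apply: filterS EW => x Wx r Wr /Wx.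
have DL : D `<=` L1_full_group T by exact: derived_subgroup_sub.
have DC : D `<=` L1_closure T D.
  move=> V DV; split; first exact: DL.
  move=> e e0; exists V => //; rewrite /L1_dist.
  under eq_integral do rewrite subrr normr0.
  by rewrite integral0 lte_fin.
have ND : N `<=` D by exact: subIsetl.
split; apply: (not_simple gN NJ _ _ NU U1 _ NW) => //.
- by move=> V [].
- exact: subset_trans DC.
- exact: DC.
Qed.
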